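(* Starting from $\mathcal X_0=\mathcal X$, the following three set-iteration schemes generate the same sequence $\{\mathcal X_k\}_{k\in\mathbb N}$, where in (i) and (ii) $\overline{\mathcal X}_{k+1}:=\bigcap_{A\in\mathscr A}A^{-1}(\mathcal X_k\ominus\mathcal W)$ is computed from the current iterate $\mathcal X_k$ of the scheme: (i) standard set iteration: $\mathcal X_{k+1}=\overline{\mathcal X}_{k+1}\cap\mathcal X$, $k\in\mathbb N$; (ii) self-restricted set iteration: $\mathcal X_{k+1}=\overline{\mathcal X}_{k+1}\cap\mathcal X_k$, $k\in\mathbb N$; (iii) incremental set iteration: $\mathcal X_{k+1}=\mathcal X_k\cap\mathcal Y_{k+1}$, $k\in\mathbb N$.
   Context: $\mathbb N$ denotes the nonnegative integers. Let $\mathscr A\subseteq\mathbb R^{n\times n}$ be a nonempty family of matrices, $\mathcal W\subseteq\mathbb R^n$ a nonempty set, and $\mathcal X\subseteq\mathbb R^n$ a set. For sets $\mathcal S,\mathcal D\subseteq\mathbb R^n$ with $\mathcal D$ nonempty, the Pontryagin difference is $\mathcal S\ominus\mathcal D:=\{z\in\mathbb R^n: z+\mathcal D\subseteq\mathcal S\}$. For a (not necessarily invertible) matrix $M$, $M^{-1}\mathcal S:=\{x: Mx\in\mathcal S\}$ is the preimage. Set $\mathcal Y_0:=\mathcal X$, and for each $k\ge1$ let $\mathcal Y_k$ be the set of initial states for which every admissible trajectory satisfies the constraint at time $k$: $$\mathcal Y_k:=\{x_0\in\mathbb R^n:\ x_k\in\mathcal X\ \ \forall A_0,\dots,A_{k-1}\in\mathscr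 A,\ \forall w_0,\dots,w_{k-1}\in\mathcal W\},$$ where $x_k$ is generated by $x_{j+1}=A_jx_j+w_j$, $j=0,\dots,k-1$. *)

(* Defs.v *)
From mathcomp Require Import all_boot all_order all_algebra.
From mathcomp Require Import boolp classical_sets reals.

Set Implicit Arguments.
Unset Strict Implicit.
Unset Printing Implicit Defensive.

Import Order.TTheory GRing.Theory Num.Theory.
Local Open Scope classical_set_scope.
Local Open Scope ring_scope.

Section SetIterations.
Variables (R : realType) (n : nat).

Definition pontryagin_diff (S D : set 'cV[R]_n) : set 'cV[R]_n :=
  [set z | [set z + d | d in D] `<=` S].

(* [A] may be singular, so this is the preimage, not the image by [invmx A]. *)
Definition mx_preimage (A : 'M[R]_n) (S : set 'cV[R]_n) : set 'cV[R]_n :=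
  (fun x : 'cV[R]_n => A *m x) @^-1` S.

Variables (cA : set 'M[R]_n) (W X : set 'cV[R]_n).

Fixpoint trajectory (A : nat -> 'M[R]_n) (w : nat -> 'cV[R]_n)
    (x0 : 'cV[R]_n) (k : nat) : 'cV[R]_n :=
  if k is j.+1 then A j *m trajectory A w x0 j + w j else x0.

(* The finite sequences A_0, ..., A_{k-1} and w_0, ..., w_{k-1} are encoded as
   functions on nat constrained only at indices below [k]; their values at
   other indices do not affect [trajectory A w x0 k]. *)
Definition constraint_set (k : nat) : set 'cV[R]_n :=
  if k is 0%N then X else
  [set x0 | forall (A : nat -> 'M[R]_n) (w : nat -> 'cV[R]_n),
     (forall j, (j < k)%N -> cA (A j)) ->
     (forall j, (j < k)%N -> W (w j)) ->
     X (trajectory A w x0 k)].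

Definition backward_set (S : set 'cV[R]_n) : set 'cV[R]_n :=
  \bigcap_(A in cA) mx_preimage A (pontryagin_diff S W).

Fixpoint standard_iter (k : nat) : set 'cV[R]_n :=
  if k is j.+1 then backward_set (standard_iter j) `&` X else X.

Fixpoint self_restricted_iter (k : nat) : set 'cV[R]_n :=
  if k is j.+1
  then backward_set (self_restricted_iter j) `&` self_restricted_iter j
  else X.

Fixpoint incremental_iter (k : nat) : set 'cV[R]_n :=
  if k is j.+1 then incremental_iter j `&` constraint_set j.+1 else X.

End SetIterations.

(* Main.v *)
Require Import Defs.
From mathcomp Require Import all_boot all_order all_algebra.
From mathcomp Require Import boolp classical_sets reals.

Local Open Scope classical_set_scope.
Local Open Scope ring_scope.

(** Write [B] for the one-step backward operator [backward_set], [Y_k] for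
    [constraint_set] and [I_k] for [incremental_iter], that is, the
    intersection of [Y_0, ..., Y_k].  Two facts drive the proof.

    - [Y_(k+1) = B Y_k] ([constraint_setS]): splitting off the first step
      [x1 = A_0 x0 + w_0] of a trajectory leaves an arbitrary admissible
      trajectory of length [k] started at [x1], because the choices at
      different times are independent.
    - [B] commutes with intersections ([backward_setI]), since membership in
      [B S] says that all the successors of a point lie in [S].

    Hence [B I_k] is the intersection of [Y_1, ..., Y_(k+1)], and so
    [I_(k+1) = B I_k `&` X]: the incremental scheme satisfies the standard
    recursion.  As the [I_k] decrease from [X], intersecting [B I_k] with [I_k]
    instead of [X] yields the same set, so the incremental scheme satisfies the
    self-restricted recursion as well. *)

Section Backward.
Context {R : realType} {n : nat}.
Implicit Types (cA : set 'M[R]_n) (W X S T : set 'cV[R]_n) (x : 'cV[R]_n).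

Lemma backward_setP cA W S x :
  backward_set cA W S x <->
  forall A w, cA A -> W w -> S (A *m x + w).
Proof.
split=> [BSx A w cAA Ww | BSx A cAA _ [w Ww <-]].
  by apply: (BSx A cAA); exists w.
exact: BSx.
Qed.

Lemma backward_setI cA W S T :
  backward_set cA W (S `&` T) = backward_set cA W S `&` backward_set cA W T.
Proof.
apply/seteqP; split=> x.
  move=> /backward_setP BSTx.
  by split; apply/backward_setP => A w cAA Ww; have [] := BSTx A w cAA Ww.
move=> [/backward_setP BSx /backward_setP BTx].
by apply/backward_setP => A w cAA Ww; split; [exact: BSx | exact: BTx].
Qed.

End Backward.

Section Constraint.
Context {R : realType} {n : nat}.
Implicit Types (cA : set 'M[R]_n) (W X : set 'cV[R]_n) (x : 'cV[R]_n).

(** [trajectory] recurses on its last step; this is the recursion on its first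
    step. *)
Lemma trajectory_shift (A : nat -> 'M[R]_n) (w : nat -> 'cV[R]_n) x k :
  trajectory A w x k.+1 =
  trajectory (fun j => A j.+1) (fun j => w j.+1) (A 0%N *m x + w 0%N) k.
Proof. by elim: k => // k /= ->. Qed.

(** The case [k = 0] needs no separate treatment: a trajectory of length zero
    stays at [x], and sequences with no constraint on them exist. *)
Lemma constraint_setP cA W X k x :
  constraint_set cA W X k x <->
  forall (A : nat -> 'M[R]_n) (w : nat -> 'cV[R]_n),
    (forall j, (j < k)%N -> cA (A j)) ->
    (forall j, (j < k)%N -> W (w j)) ->
    X (trajectory A w x k).
Proof.
case: k => [|k] //=; split=> [//|Xx].
exact: (Xx (fun=> 0) (fun=> 0)).
Qed.

Lemma constraint_setS cA W X k :
  constraint_set cA W X k.+1 = backward_set cA W (constraint_set cA W X k).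
Proof.
apply/seteqP; split=> x.
  move=> /constraint_setP Yx; apply/backward_setP => A0 w0 cAA0 Ww0.
  apply/constraint_setP => A w cAA Ww.
  (* Prepend the first step to the given sequences. *)
  have := Yx (fun j => if j is i.+1 then A i else A0)
             (fun j => if j is i.+1 then w i else w0).
  by rewrite trajectory_shift; apply; case.
move=> /backward_setP BYx; apply/constraint_setP => A w cAA Ww.
rewrite trajectory_shift.
have /constraint_setP := BYx _ _ (cAA 0%N isT) (Ww 0%N isT).
by apply=> j ltjk; [exact: cAA | exact: Ww].
Qed.

End Constraint.

Section Incremental.
Context {R : realType} {n : nat}.
Implicit Types (cA : set 'M[R]_n) (W X : set 'cV[R]_n).

Lemma incremental_iter_sub cA W X k : incremental_iter cA W X k `<=` X.
Proof. by elim: k => [|k IHk] // x [/IHk]. Qed.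

Lemma incremental_iter_standard cA W X k :
  incremental_iter cA W X k.+1 =
  backward_set cA W (incremental_iter cA W X k) `&` X.
Proof.
elim: k => [|k IHk].
  by rewrite /incremental_iter constraint_setS setIC.
rewrite -[LHS]/(incremental_iter cA W X k.+1 `&` constraint_set cA W X k.+2).
by rewrite {1}IHk constraint_setS setIAC -backward_setI.
Qed.

Lemma incremental_iter_self_restricted cA W X k :
  incremental_iter cA W X k.+1 =
  backward_set cA W (incremental_iter cA W X k) `&` incremental_iter cA W X k.
Proof.
apply/seteqP; split=> x.
  move=> Ix; split; last by case: Ix.
  by move: Ix; rewrite incremental_iter_standard => -[].
by rewrite incremental_iter_standard => -[BIx /incremental_iter_sub].
Qed.

End Incremental.

Theorem proposition1 (R : realType) (n : nat)
    (cA : set 'M[R]_n) (W X : set 'cV[R]_n)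
    (hA : cA !=set0) (hW : W !=set0) :
  forall k : nat,
    standard_iter cA W X k = self_restricted_iter cA W X k /\
    self_restricted_iter cA W X k = incremental_iter cA W X k.
Proof.
have standardE k : standard_iter cA W X k = incremental_iter cA W X k.
  by elim: k => // k IHk; rewrite incremental_iter_standard -IHk.
have selfE k : self_restricted_iter cA W X k = incremental_iter cA W X k.
  by elim: k => // k IHk; rewrite incremental_iter_self_restricted -IHk.
by move=> k; rewrite standardE selfE.
Qed.
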